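(* Let $a,b$ be relatively prime positive integers and let $P$ be an $(a,b)$-Dyck path. Then the skew length of $P$ is equal to the skew length of the conjugate path $P^c$.
   Context: An $(a,b)$-Dyck path is a lattice path from $(0,0)$ to $(b,a)$ with unit north steps and unit east steps, all of whose lattice points $(x,y)$ satisfy $ax\le by$; it is drawn in the grid with $a$ rows and $b$ columns. Hooks and cores: the unit box with southeast corner $(x,y)$ has hook filling $by-ax$. The positive hooks of $P$ are the positive hook fillings of the boxes of the grid lying below (southeast of) $P$. $\mathfrak{c}(P)$ is the partition whose set of first-column hook lengths is the set of positive hooks of $P$ (it is an $(a,b)$-core, i.e. has no hook length equal to $a$ or $b$). For a partition $\kappa$ and a positive integer $m$: consider the hook lengths of the boxes in the first column of $\kappa$; for each residue modulo $m$ that occurs take the largest such hook length; the rows of $\kappa$ with these first-column hook lengths are the $m$-rows of $\kappa$. The $m$-boundary of $\kappa$ is the set of boxes with hook length less than $m$. The skew length of an $(a,b)$-core $\kappa$ is the number of boxes simultaneously located in the $a$-rows and the $b$-boundary of $\kappa$; the skew length of $P$ is the skew length of $\mathfrak{c}(P)$. Conjugation: $P^c$ is obtained by applying cyclic shifts to the step sequence of $P$ until a path lying strictly below the diagonal from $(0,0)$ to $(b,a)$ (except at its two endpoints) is obtained (there is exactly one such cyclic shift), and rotating this path by $180^\circ$. *)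

(* Defs.v *)
From mathcomp Require Import all_boot zify.

Set Implicit Arguments.
Unset Strict Implicit.
Unset Printing Implicit Defensive.

(** A path from the origin is its sequence of unit steps:
    [true] is a north step, [false] an east step. *)
Notation lattice_path := (seq bool).

(** The point reached after the first [k] steps is (xcoord P k, ycoord P k). *)
Definition xcoord (P : lattice_path) (k : nat) : nat := count negb (take k P).
Definition ycoord (P : lattice_path) (k : nat) : nat := count id (take k P).

Definition path_to (b a : nat) (P : lattice_path) : bool :=
  (count negb P == b) && (count id P == a).

Definition dyck_path (a b : nat) (P : lattice_path) : bool :=
  path_to b a P &&
  all (fun k => a * xcoord P k <= b * ycoord P k) (iota 0 (size P).+1).

Definition strictly_below_diagonal (a b : nat) (P : lattice_path) : bool :=
  path_to b a P &&
  all (fun k => b * ycoord P k < a * xcoord P k) (iota 1 (size P).-1).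

(** Shift cyclically until the path is strictly below the diagonal, then rotate
    it by 180 degrees: each step keeps its type and the order is reversed.
    [exists_unique_shift] below shows that the search succeeds. *)
Definition conj_path (a b : nat) (P : lattice_path) : lattice_path :=
  rev (rot (find (fun k => strictly_below_diagonal a b (rot k P))
                 (iota 0 (size P))) P).

(** Boxes of the grid with [a] rows and [b] columns, given by their southeast
    corners (x, y), with 1 <= x <= b and 0 <= y < a. *)
Definition grid_boxes (a b : nat) : seq (nat * nat) :=
  [seq (x, y) | x <- iota 1 b, y <- iota 0 a].

(** The box [x - 1, x] x [y, y + 1] lies below [P] when the east step of [P]
    from abscissa x - 1 to x has height at least y + 1. *)
Definition box_below (P : lattice_path) (c : nat * nat) : bool :=
  has (fun k => [&& ~~ nth true P k, (xcoord P k).+1 == c.1 & c.2 < ycoord P k])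
      (iota 0 (size P)).

(** The hook filling of the box with southeast corner (x, y) is b y - a x. The
    subtraction is only evaluated where this is positive, so never truncates. *)
Definition positive_hooks (a b : nat) (P : lattice_path) : seq nat :=
  [seq b * c.2 - a * c.1
     | c <- [seq c <- grid_boxes a b | box_below P c && (a * c.1 < b * c.2)]].

Definition is_partition (k : seq nat) : bool := sorted geq k && (0 \notin k).

(** Rows and columns are numbered from 0. *)
Definition diagram (k : seq nat) : seq (nat * nat) :=
  [seq (i, j) | i <- iota 0 (size k), j <- iota 0 (nth 0 k i)].

Definition arm (k : seq nat) (i j : nat) : nat := nth 0 k i - j.+1.
Definition leg (k : seq nat) (i j : nat) : nat := count (ltn j) k - i.+1.
Definition hook_length (k : seq nat) (i j : nat) : nat :=
  arm k i j + leg k i j + 1.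

Definition first_column_hooks (k : seq nat) : seq nat :=
  [seq hook_length k i 0 | i <- iota 0 (size k)].

Definition in_m_rows (m : nat) (k : seq nat) (i : nat) : bool :=
  (i < size k) &&
  all (fun h => (h == hook_length k i 0 %[mod m]) ==> (h <= hook_length k i 0))
      (first_column_hooks k).

Definition in_m_boundary (m : nat) (k : seq nat) (c : nat * nat) : bool :=
  (c \in diagram k) && (hook_length k c.1 c.2 < m).

Definition skew_length (a b : nat) (k : seq nat) : nat :=
  count (fun c => in_m_rows a k c.1 && in_m_boundary b k c) (diagram k).

(** The partition whose set of first-column hook lengths is [H]: listing [H] as
    h_0 > ... > h_(n-1), its parts are h_i - (n - 1 - i). This is justified by
    [partition_of_hooksP] and [partition_of_hooks_uniq]. *)
Definition partition_of_hooks (H : seq nat) : seq nat :=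
  let s := sort geq (undup H) in
  [seq nth 0 s i - (size s - i.+1) | i <- iota 0 (size s)].

Definition core_of_path (a b : nat) (P : lattice_path) : seq nat :=
  partition_of_hooks (positive_hooks a b P).

Definition path_skew_length (a b : nat) (P : lattice_path) : nat :=
  skew_length a b (core_of_path a b P).

Lemma coord_take P k : k <= size P -> xcoord P k + ycoord P k = k.
Proof.
move=> kP; rewrite /xcoord /ycoord addnC -[in RHS](size_takel kP).
exact: count_predC.
Qed.

Lemma xcoord_mono P i j : i <= j -> xcoord P i <= xcoord P j.
Proof.
move=> ij; rewrite /xcoord -(subnKC ij) takeD count_cat; exact: leq_addr.
Qed.

Lemma ycoord_mono P i j : i <= j -> ycoord P i <= ycoord P j.
Proof.
move=> ij; rewrite /ycoord -(subnKC ij) takeD count_cat; exact: leq_addr.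
Qed.

Lemma count_take_rot (p : pred bool) (P : lattice_path) k j :
  k < size P -> j < size P ->
  count p (take j (rot k P)) + count p (take k P) =
  if k + j < size P then count p (take (k + j) P)
  else count p P + count p (take (k + j - size P) P).
Proof.
move=> kP jP; rewrite /rot take_cat size_drop.
have -> : (j < size P - k) = (k + j < size P) by lia.
case: ifP => h; first by rewrite takeD count_cat addnC.
rewrite count_cat take_takel; last by lia.
have -> : j - (size P - k) = k + j - size P by lia.
have -> : count p P = count p (take k P) + count p (drop k P).
  by rewrite -count_cat cat_take_drop.
lia.
Qed.

Lemma exists_unique_shift a b P :
  0 < a -> 0 < b -> coprime a b -> path_to b a P ->
  exists! k, (k < size P) && strictly_below_diagonal a b (rot k P).
Proof.
move=> a0 b0 ab /[dup] Pto /andP[/eqP xP /eqP yP].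
have sP : size P = b + a by rewrite -(count_predC id P) yP addnC -xP.
have xle k : xcoord P k <= b.
  rewrite -xP -[X in _ <= count _ X](cat_take_drop k P) count_cat; exact: leq_addr.
(* the height above the diagonal, translated by a * b *)
pose f k := b * ycoord P k + a * (b - xcoord P k).
have flt i j : i < j < size P -> f i != f j.
  move=> /andP[ij jP]; apply/eqP => fE.
  have ci := @coord_take P i ltac:(lia); have cj := @coord_take P j ltac:(lia).
  have xm := @xcoord_mono P i j ltac:(lia).
  have ym := @ycoord_mono P i j ltac:(lia).
  have [xi xj] := (xle i, xle j).
  have dE : b * (ycoord P j - ycoord P i) = a * (xcoord P j - xcoord P i).
    have [e yE] : exists e, ycoord P j = ycoord P i + e by exists (ycoord P j - ycoord P i); lia.
    have [d xE] : exists d, xcoord P j = xcoord P i + d by exists (xcoord P j - xcoord P i); lia.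
    move: fE; rewrite /f yE xE !addKn mulnDr.
    have -> : b - xcoord P i = d + (b - (xcoord P i + d)) by lia.
    rewrite mulnDr; lia.
  have : b %| xcoord P j - xcoord P i.
    by rewrite -(@Gauss_dvdr b a) 1?coprime_sym // -dE dvdn_mulr.
  have [xE _|x0] := posnP (xcoord P j - xcoord P i); last first.
    move=> /(dvdn_leq x0) bx.
    have xE : xcoord P j - xcoord P i = b by lia.
    by move: dE; rewrite xE mulnC => /eqP; rewrite eqn_pmul2r // => /eqP; lia.
  by move: dE => /eqP; rewrite xE muln0 muln_eq0 => /orP[/eqP|/eqP]; lia.
have finj i j : i < size P -> j < size P -> f i = f j -> i = j.
  move=> iP jP fE; case: (ltngtP i j) => // h.
    by have := flt i j; rewrite h jP fE eqxx => /(_ isT).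
  by have := flt j i; rewrite h iP fE eqxx => /(_ isT).
have below k : k < size P -> reflect
    (forall i, i < size P -> i != k -> f i < f k)
    (strictly_below_diagonal a b (rot k P)).
  move=> kP.
  have rto : path_to b a (rot k P).
    have cr p : count p (rot k P) = count p P by apply/permP; rewrite perm_rot.
    by rewrite /path_to !cr.
  have fx j : 0 < j < size P -> exists2 i,
      i = (if k + j < size P then k + j else k + j - size P) &
      (b * ycoord (rot k P) j < a * xcoord (rot k P) j) = (f i < f k).
    move=> /andP[j0 jP]; eexists; first by [].
    have := count_take_rot negb kP jP; have := count_take_rot id kP jP.
    rewrite -!/(xcoord _ _) -!/(ycoord _ _) xP yP /f; have := xle k.
    case: ifP => h xk yE xE.
      have := xle (k + j); rewrite -xE -yE => x1k.
      have -> : b - xcoord P k = xcoord (rot k P) j +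
        (b - (xcoord (rot k P) j + xcoord P k)) by lia.
      rewrite !mulnDr; lia.
    have x'b := xle (k + j - size P).
    have {}yE := congr1 (muln b) yE.
    have {xE}: a * (b - xcoord P (k + j - size P)) + a * xcoord (rot k P) j =
        a * b + a * (b - xcoord P k) by rewrite -!mulnDr; congr muln; lia.
    rewrite !mulnDr in yE; lia.
  apply: (iffP idP) => [/andP[_ /allP H] i iP ik|H].
    pose j := if k < i then i - k else i + size P - k.
    have j0 : 0 < j < size P by rewrite /j; move/eqP: ik; case: ifP; lia.
    have [i' -> <-] : exists2 i', i' = i &
      (b * ycoord (rot k P) j < a * xcoord (rot k P) j) = (f i' < f k).
      have [i' iE E] := fx j j0; exists i' => //; rewrite iE /j.
      case: (ltnP k i) => h1; case: ifP => h2; move/eqP: ik; lia.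
    by apply: H; rewrite mem_iota size_rot; lia.
  rewrite /strictly_below_diagonal rto; apply/allP => j.
  rewrite mem_iota size_rot => jP.
  have [i iE ->] := fx j ltac:(lia).
  by apply: H; [|apply/eqP]; move: iE; case: ifP; lia.
have P0 : 0 < size P by lia.
case: (@arg_maxnP _ (Ordinal P0) xpredT f isT) => /= m _ mmax.
exists m; split=> [|k /andP[kP /(below k kP) H]].
  rewrite ltn_ord; apply/below => // i iP im.
  rewrite ltn_neqAle (mmax (Ordinal iP) isT) andbT.
  by apply: contra im => /eqP /finj ->.
apply/eqP/negPn/negP => mk; have := H m (ltn_ord m) mk.
by rewrite ltnNge (mmax (Ordinal kP) isT).
Qed.

Lemma hook_length0 k i : is_partition k -> i < size k ->
  hook_length k i 0 = nth 0 k i + (size k - i.+1).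
Proof.
move=> /andP[_ k0] ik; rewrite /hook_length /arm /leg.
have -> : count (ltn 0) k = size k.
  apply/eqP; rewrite -all_count; apply/allP => x xk /=.
  by rewrite lt0n; apply: contraNneq k0 => <-.
have : 0 < nth 0 k i by rewrite lt0n; apply: contraNneq k0 => <-; apply: mem_nth.
lia.
Qed.

Lemma first_column_hooksE k : is_partition k ->
  first_column_hooks k = mkseq (fun i => nth 0 k i + (size k - i.+1)) (size k).
Proof.
move=> kp; apply/eq_in_map => i; rewrite mem_iota => /andP[_ ik].
exact: hook_length0.
Qed.

Lemma first_column_hooks_sorted k :
  is_partition k -> sorted gtn (first_column_hooks k).
Proof.
move=> kp; rewrite first_column_hooksE //; case/andP: kp => ks _.
apply/(sortedP 0) => i; rewrite size_mkseq => ik.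
rewrite !nth_mkseq //=; last by lia.
by have /= := sortedP 0 ks i ik; lia.
Qed.

Lemma partition_of_hooks_uniq H k : is_partition k ->
  first_column_hooks k =i H -> k = partition_of_hooks H.
Proof.
move=> kp kH; have fs := first_column_hooks_sorted kp.
have fE : sort geq (undup H) = first_column_hooks k.
  apply: (@sorted_eq _ geq) => [y x z /=|x y /=|||]; try lia.
  - by apply: sort_sorted => x y /=; lia.
  - by apply: sub_sorted fs => x y /=; lia.
  rewrite perm_sort; apply: uniq_perm; first exact: undup_uniq.
    by apply: (@sorted_uniq _ gtn) fs => [y x z /=|x /=]; lia.
  by move=> x; rewrite mem_undup kH.
rewrite /partition_of_hooks fE first_column_hooksE // size_mkseq.
rewrite -[LHS](mkseq_nth 0); apply/eq_in_map => i.
rewrite mem_iota => /andP[_ ik]; rewrite nth_mkseq //; lia.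
Qed.

Lemma partition_of_hooksP H : 0 \notin H ->
  is_partition (partition_of_hooks H) /\
  first_column_hooks (partition_of_hooks H) =i H.
Proof.
move=> H0; rewrite /partition_of_hooks; set s := sort geq (undup H).
have sH : s =i H by move=> x; rewrite mem_sort mem_undup.
have ss : sorted gtn s.
  have : sorted geq s by apply: sort_sorted => x y /=; lia.
  have : uniq s by rewrite sort_uniq undup_uniq.
  rewrite uniq_pairwise !sorted_pairwise; try by move=> y x z /=; lia.
  move=> u; move/(conj u)/andP; rewrite -pairwise_relI.
  by apply: sub_pairwise => x y /=; lia.
have spos i : i < size s -> size s - i <= nth 0 s i.
  move: (size s - i) {-2}i (leqnn (size s - i)) => d; elim: d => [|d IH] j dj js.
    lia.
  have [j1|j1] := ltnP j.+1 (size s); last first.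
    have : nth 0 s j != 0 by apply: contraNneq H0 => <-; rewrite -sH mem_nth.
    lia.
  have := IH j.+1 ltac:(lia) j1; have /= := sortedP 0 ss j j1; lia.
set k := [seq _ | i <- _].
have sk : size k = size s by rewrite size_map size_iota.
have nk i : i < size s -> nth 0 k i = nth 0 s i - (size s - i.+1).
  by move=> is'; rewrite (nth_mkseq 0).
have kp : is_partition k.
  apply/andP; split.
    apply/(sortedP 0) => i; rewrite sk => i1; rewrite !nk //=; last by lia.
    by have /= := sortedP 0 ss i i1; have := spos _ i1; lia.
  apply/negP => /(nthP 0)[i]; rewrite sk => is'; rewrite nk // => E.
  by have := spos i is'; lia.
split=> // x; rewrite -sH first_column_hooksE // sk.
suff -> : mkseq (fun i => nth 0 k i + (size s - i.+1)) (size s) = s by [].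
rewrite -[RHS](mkseq_nth 0); apply/eq_in_map => i.
rewrite mem_iota => /andP[_ is']; rewrite nk //; have := spos i is'; lia.
Qed.

Lemma core_of_pathP a b P : is_partition (core_of_path a b P) /\
  first_column_hooks (core_of_path a b P) =i positive_hooks a b P.
Proof.
apply: partition_of_hooksP; apply/negP => /mapP[c].
by rewrite mem_filter => /andP[/andP[_ h] _]; lia.
Qed.

(* Main.v *)
Require Import Defs.
From mathcomp Require Import all_boot ssralg ssrnum ssrint intdiv zify ring.

Set Implicit Arguments.
Unset Strict Implicit.
Unset Printing Implicit Defensive.

Import GRing.Theory.

(** Give the lattice point (x, y) the level b y - a x, and let A be the list of
    the levels at which the north steps of a Dyck path P start. By coprimality A
    contains exactly one integer of each residue class modulo a, and the positive
    hooks of P are the positive integers obtained from the elements of A by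
    subtracting a at least once ([mem_positive_hooks]). Thus A is the abacus of
    the core c(P): on the runner of x in A, the beads are at x - a, x - 2a, ...

    The hook lengths in a row whose first-column hook is h are the differences
    h - g with g < h a gap, that is a number that is not a first-column hook
    ([mem_row_hooks]). The a-rows are those with h = x - a for x in A. The gaps
    on the runner of y in A are y, y + a, ..., so that the hook lengths below b
    contributed by the pair (x, y) are the t with 0 < t < b, t < x - y and
    t = x - y modulo a. Their number depends on x - y only, and
    [skew_length_pair_hooks] writes the skew length as the sum of this number
    over all pairs (x, y) in A x A.

    A cyclic shift of P translates A. A rotation by 180 degrees reflects it:
    A becomes c - A for a constant c, because it preserves north steps and
    reverses levels. The sum over A x A of a function of x - y is invariant
    under translation, and also under reflection, which only exchanges the two
    components of the pairs ([pair_hooks_reflect]). Hence P and its conjugate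
    have the same skew length. *)

(** * Hook lengths in the rows of a partition *)

(** As the parts decrease, those exceeding [j] form a prefix: the count is the
    length of column [j]. *)
Lemma ltn_nth_count k j l : sorted geq k ->
  (j < nth 0 k l) = (l < count (ltn j) k).
Proof.
elim: k l => [|x k IH] l ks; first by rewrite nth_nil.
have kx : all (geq x) k by apply: order_path_min ks => y u z /=; lia.
case: l => [|l] /=; last first.
  rewrite (IH _ (path_sorted ks)); case: (ltnP j x) => // jx.
  suff -> : count (ltn j) k = 0 by [].
  apply/eqP; rewrite -leqn0 leqNgt -has_count; apply/hasPn => y /(allP kx) /=.
  lia.
case: (ltnP j x) => // jx; rewrite add0n -has_count.
by apply/esym/hasPn => y /(allP kx) /=; lia.
Qed.

Definition top_hook (a : nat) (H : seq nat) (h : nat) : bool :=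
  all (fun h' => (h' == h %[mod a]) ==> (h' <= h)) H.

Section Row.
Variables (k : seq nat) (kp : is_partition k).

Let fc_nth l : l < size k ->
  nth 0 (first_column_hooks k) l = nth 0 k l + (size k - l.+1).
Proof. by move=> lk; rewrite first_column_hooksE // nth_mkseq. Qed.

Lemma first_column_hooks_uniq : uniq (first_column_hooks k).
Proof.
by apply: (@sorted_uniq _ gtn) (first_column_hooks_sorted kp) => [y x z|x] /=; lia.
Qed.

Lemma hook_length_decr i j j' : j < j' < nth 0 k i ->
  hook_length k i j' < hook_length k i j.
Proof.
move=> jj; have cc : count (ltn j') k <= count (ltn j) k.
  by apply: sub_count => x /=; lia.
rewrite /hook_length /arm /leg; lia.
Qed.

Lemma row_hooks_uniq i : uniq [seq hook_length k i j | j <- iota 0 (nth 0 k i)].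
Proof.
rewrite map_inj_in_uniq ?iota_uniq // => j j'; rewrite !mem_iota => ji j'i E.
case: (ltngtP j j') => // jj.
  by have := @hook_length_decr i j j' ltac:(lia); lia.
by have := @hook_length_decr i j' j ltac:(lia); lia.
Qed.

(** The classical description of the hooks of a row by its gaps. With [c] the
    length of column [j], the hook at [(i, j)] is [h - g] for [g = j + (n - c)],
    where [n] is the number of parts. No first-column hook equals [g]: those of
    the [c] first rows are larger, the others smaller. This embeds the boxes of
    the row into the gaps below [h], and counting shows that it is onto. *)
Lemma mem_row_hooks i t : i < size k ->
  (t \in [seq hook_length k i j | j <- iota 0 (nth 0 k i)]) =
  (0 < t <= hook_length k i 0) &&
  (hook_length k i 0 - t \notin first_column_hooks k).
Proof.
move=> ik; case/andP: (kp) => ks _.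
set h := hook_length k i 0; set fc := first_column_hooks k.
have hE : h = nth 0 k i + (size k - i.+1) by apply: hook_length0.
pose gaps := [seq g <- iota 0 h | g \notin fc].
have -> : (0 < t <= h) && (h - t \notin fc) = (t \in [seq h - g | g <- gaps]).
  apply/idP/mapP => [/andP[t0 tH]|[g]].
    by exists (h - t); rewrite ?mem_filter ?mem_iota ?tH /=; lia.
  rewrite mem_filter mem_iota => /andP[gfc gh] ->.
  by rewrite subKn ?gfc; lia.
apply: (uniq_min_size (row_hooks_uniq i) _ _).2 => {t} [t|].
  move=> /mapP[j]; rewrite mem_iota => /andP[_ ji] ->.
  have ij : i < count (ltn j) k by rewrite -ltn_nth_count.
  have cs := count_size (ltn j) k.
  apply/mapP; exists (j + (size k - count (ltn j) k)); last first.
    by rewrite hE /hook_length /arm /leg; lia.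
  rewrite mem_filter mem_iota hE; apply/andP; split; last by lia.
  apply/(nthP 0) => -[l]; rewrite size_map size_iota => lk.
  rewrite fc_nth //; have := ltn_nth_count j l ks.
  by case: (ltnP l (count (ltn j) k)); lia.
rewrite !size_map size_iota size_filter.
have := count_predC (mem fc) (iota 0 h); rewrite size_iota.
(* the rows below row i supply distinct first-column hooks smaller than h *)
suff : size k - i.+1 <= count (mem fc) (iota 0 h).
  by rewrite (@eq_count _ (predC _) (fun g => g \notin fc)) //; lia.
rewrite -size_filter.
rewrite -[X in X <= _](size_iota i.+1) -(size_map (nth 0 fc)).
apply: uniq_leq_size.
  rewrite map_inj_in_uniq ?iota_uniq // => l l'; rewrite !mem_iota => lk l'k.
  by move/eqP; rewrite nth_uniq ?first_column_hooks_uniq ?size_map ?size_iota; lia.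
move=> _ /mapP[l lk ->]; rewrite mem_iota in lk.
rewrite mem_filter /= mem_nth ?size_map ?size_iota ?mem_iota; last by lia.
rewrite fc_nth ?hE /=; last by lia.
have := ltn_nth_count (nth 0 k i) l ks; have := ltn_nth_count (nth 0 k i) i ks.
lia.
Qed.

(** Regroups the boxes by rows, then the boxes of an a-row by their hook
    length [t], using that a row has no repeated hook length. *)
Lemma skew_lengthE a b : let fc := first_column_hooks k in
  skew_length a b k =
  \sum_(h <- fc | top_hook a fc h)
    count (fun t => (t <= h) && (h - t \notin fc)) (iota 1 b.-1).
Proof.
move=> fc; rewrite /skew_length -sum1_count big_mkcond big_allpairs_dep /=.
rewrite {2}/fc {1}/first_column_hooks big_map [RHS]big_mkcond /=.
apply: eq_big_seq => i; rewrite mem_iota => /andP[_ ik].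
rewrite /in_m_rows ik /= -/fc -/(top_hook _ _ _); case: ifP => rowi; last first.
  by rewrite big1_seq // => j; rewrite andFb.
rewrite -big_mkcond /= sum1_count -[RHS]size_filter.
rewrite (@eq_in_count _ _ (preim (hook_length k i) (fun t => t < b))); last first.
  move=> j ji /=; rewrite /in_m_boundary /=; case: (_ < b); rewrite ?andbF ?andbT //.
  by apply/allpairsPdep; exists i, j; rewrite mem_iota.
rewrite -count_map -size_filter; apply/perm_size/uniq_perm.
- by rewrite filter_uniq ?row_hooks_uniq.
- by rewrite filter_uniq ?iota_uniq.
move=> t; rewrite !mem_filter mem_row_hooks // mem_iota -/fc.
by case: (_ \notin fc); lia.
Qed.

End Row.

(** * Boxes below a path and conjugate Dyck paths *)

(** A discrete intermediate value property, used for both kinds of steps. *)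
Lemma step_exists (p : pred bool) (P : lattice_path) s0 n : n < count p P ->
  exists k, [/\ k < size P, p (nth s0 P k) & count p (take k P) = n].
Proof.
elim: P n => [|s P IH] n //=; case: (boolP (p s)) => ps.
  case: n => [|n] nP; first by exists 0.
  have [k [kP pk kn]] := IH n ltac:(lia).
  by exists k.+1; split=> //=; rewrite ps kn.
move=> nP; have [k [kP pk kn]] := IH n nP.
by exists k.+1; split=> //=; rewrite (negbTE ps) kn.
Qed.

Lemma count_take_lt (p : pred bool) (P : lattice_path) s0 i j : i < size P -> i < j ->
  p (nth s0 P i) -> count p (take i P) < count p (take j P).
Proof.
move=> iP ij pi; have [js|sj] := leqP (size P) j.
  rewrite (take_oversize js) -{2}(cat_take_drop i P) count_cat (drop_nth s0) //=.
  by rewrite pi; lia.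
rewrite -(subnKC (ltnW ij)) takeD count_cat (drop_nth s0) //.
by case E: (j - i) => [|d] /=; rewrite ?pi; lia.
Qed.

(** The definition of a box below a path looks up at the path along a column;
    this is the same condition read along a row. The two agree because the path
    is monotone, so that the east step of the box's column comes after the north
    step of its row. *)
Lemma box_belowP (P : lattice_path) x y :
  0 < x <= count negb P -> y < count id P ->
  reflect (exists k, [/\ k < size P, nth false P k, ycoord P k = y & xcoord P k < x])
          (box_below P (x, y)).
Proof.
move=> /andP[x0 xb] ya; apply: (iffP hasP) => [[k]|[k [kP Nk ky kx]]].
  rewrite mem_iota /= => kP /and3P[Ek /eqP xE yk].
  have [i [iP Ni iy]] := step_exists false ya.
  exists i; split=> //; rewrite -xE ltnS; apply: xcoord_mono.
  by rewrite leqNgt; apply/negP => /ltnW/(ycoord_mono P); rewrite /ycoord iy -/(ycoord _ _); lia.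
have [i [iP Ei ix]] := @step_exists negb P true x.-1 ltac:(lia).
exists i; first by rewrite mem_iota.
rewrite Ei /= /xcoord ix prednK // eqxx /=.
have ki : k < i.
  rewrite ltnNge leq_eqVlt; apply/negP => /orP[/eqP ik|ik].
    by rewrite ik (set_nth_default false) ?Nk -?ik // in Ei.
  have := count_take_lt iP ik Ei; rewrite ix -/(xcoord _ _); lia.
by rewrite -ky; apply: (count_take_lt kP ki Nk).
Qed.

(** Rotation maps the point [(x, y)] to [(b - x, a - y)], hence exchanges the
    two sides of the diagonal. *)
Lemma dyck_path_rev a b P :
  strictly_below_diagonal a b P -> dyck_path a b (rev P).
Proof.
move=> /andP[Pto /allP Pb]; rewrite /dyck_path /path_to !count_rev -/(path_to b a P) Pto.
case/andP: Pto => /eqP xP /eqP yP.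
have sP : size P = b + a by rewrite -(count_predC id P) yP addnC -xP.
apply/allP => k; rewrite mem_iota size_rev => kP.
have xE : xcoord (rev P) k + xcoord P (size P - k) = b.
  by rewrite /xcoord take_rev count_rev addnC -count_cat cat_take_drop.
have yE : ycoord (rev P) k + ycoord P (size P - k) = a.
  by rewrite /ycoord take_rev count_rev addnC -count_cat cat_take_drop.
suff : b * ycoord P (size P - k) <= a * xcoord P (size P - k) by nia.
have [k0|k0] := posnP k.
  by rewrite k0 subn0 /ycoord /xcoord take_size xP yP mulnC.
have [->|ks] := eqVneq k (size P); first by rewrite subnn /ycoord take0 muln0.
by apply/ltnW/Pb; rewrite mem_iota; lia.
Qed.

Lemma dyck_conj_path a b P : 0 < a -> 0 < b -> coprime a b -> dyck_path a b P ->
  dyck_path a b (conj_path a b P).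
Proof.
move=> a0 b0 ab /andP[Pto _]; apply: dyck_path_rev.
have [k [/andP[kP kb] _]] := exists_unique_shift a0 b0 ab Pto.
set p := fun k => _; have hp : has p (iota 0 (size P)).
  by apply/hasP; exists k; rewrite ?mem_iota.
have := nth_find 0 hp; rewrite nth_iota //.
by rewrite -[X in _ < X](size_iota 0) -has_find.
Qed.

(** * Starting levels of north steps *)

Local Open Scope ring_scope.

(** The starting level [l] is an arbitrary integer, so that a path can be cut
    into two pieces and the pieces treated separately. *)
Fixpoint north_levels (a b : nat) (l : int) (P : lattice_path) : seq int :=
  match P with
  | [::] => [::]
  | true :: P' => l :: north_levels a b (l + b%:Z) P'
  | false :: P' => north_levels a b (l - a%:Z) P'
  end.

Definition rise (a b : nat) (P : lattice_path) : int :=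
  b%:Z * (count id P)%:Z - a%:Z * (count negb P)%:Z.

Lemma rise_cons a b s P :
  rise a b (s :: P) = (if s then b%:Z else - a%:Z) + rise a b P.
Proof. rewrite /rise /=; case: s; lia. Qed.

Lemma rise_cat a b P Q : rise a b (P ++ Q) = rise a b P + rise a b Q.
Proof. rewrite /rise !count_cat; lia. Qed.

Lemma north_levels_cat a b l P Q :
  north_levels a b l (P ++ Q) =
  north_levels a b l P ++ north_levels a b (l + rise a b P) Q.
Proof.
elim: P l => [|[] P IH] l /=; first by congr north_levels; rewrite /rise /=; lia.
  by rewrite IH rise_cons (addrA l).
by rewrite IH rise_cons (addrA l).
Qed.

Lemma north_levels_shift a b c l P :
  north_levels a b (l + c) P = [seq x + c | x <- north_levels a b l P].
Proof.
by elim: P l => [|[] P IH] l //=; rewrite (addrAC l c) IH.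
Qed.

Lemma rise_rev a b P : rise a b (rev P) = rise a b P.
Proof. by rewrite /rise !count_rev. Qed.

(** The north step that starts at level [x] and ends at [x + b] becomes a step
    that starts at the image of [x + b]; levels are reflected by the reversal. *)
Lemma north_levels_rev a b l m P :
  north_levels a b l (rev P) =
  rev [seq (l + m + rise a b P - b%:Z) - x | x <- north_levels a b m P].
Proof.
elim: P m => [|s P IH] m //=.
rewrite rev_cons -cats1 north_levels_cat rise_rev.
case: s; rewrite rise_cons /= ?cats0 ?rev_cons.
  rewrite (IH (m + b%:Z)) -cats1; congr (_ ++ [:: _]); last by lia.
  by congr rev; apply: eq_map => x; lia.
by rewrite (IH (m - a%:Z)); congr rev; apply: eq_map => x; lia.
Qed.

(** Since a closed path returns to its initial level, exchanging its two parts
    changes all levels by the same amount. *)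
Lemma north_levels_rot a b k P : rise a b P = 0 ->
  exists c, perm_eq (north_levels a b 0 (rot k P))
                    [seq x + c | x <- north_levels a b 0 P].
Proof.
move=> r0; exists (- rise a b (take k P)).
have -> : north_levels a b 0 P =
    north_levels a b 0 (take k P) ++ north_levels a b (rise a b (take k P)) (drop k P).
  by rewrite -{1}(cat_take_drop k P) north_levels_cat add0r.
rewrite /rot north_levels_cat map_cat perm_catC -!north_levels_shift subrr !add0r.
have -> // : rise a b (drop k P) = - rise a b (take k P).
by move: r0; rewrite -{1}(cat_take_drop k P) rise_cat; lia.
Qed.

Lemma north_levelsP a b l P (x : int) :
  reflect (exists k, [/\ (k < size P)%N, nth false P k &
             x = l + b%:Z * (ycoord P k)%:Z - a%:Z * (xcoord P k)%:Z])
          (x \in north_levels a b l P).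
Proof.
elim: P l => [|s P IH] l; first by apply: ReflectF => -[k []].
have IH' m : x \in north_levels a b m P <-> exists k, [/\ (k < size P)%N, nth false P k &
             x = m + b%:Z * (ycoord P k)%:Z - a%:Z * (xcoord P k)%:Z].
  by split=> /IH.
case: s => /=; rewrite ?inE; apply: (iffP idP).
- case/orP => [/eqP ->|/IH' [k [kP Nk ->]]].
    by exists 0%N; split=> //; rewrite /ycoord /xcoord /=; lia.
  by exists k.+1; split=> //; rewrite /ycoord /xcoord /=; lia.
- case=> [[|k]] [kP Nk xE]; apply/orP.
    by left; apply/eqP; rewrite xE /ycoord /xcoord /=; lia.
  right; apply/IH'; exists k; split=> //.
  by rewrite xE /ycoord /xcoord /=; lia.
- case/IH' => k [kP Nk ->].
  by exists k.+1; split=> //; rewrite /ycoord /xcoord /=; lia.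
- case=> [[|k]] [kP Nk xE] //; apply/IH'; exists k; split=> //.
  by rewrite xE /ycoord /xcoord /=; lia.
Qed.

(** The numbers [b y] for [y < a] represent each residue class modulo [a] once:
    a solution comes from Bezout, its uniqueness from Gauss. *)
Lemma count_residue a b z : (0 < a)%N -> coprime a b ->
  count (fun y : nat => (a %| b%:Z * y%:Z - z)%Z) (iota 0 a) = 1%N.
Proof.
move=> a0 ab.
have [u [v uv]] : exists u v : int, u * a%:Z + v * b%:Z = 1.
  have [u [v E]] := Bezoutz a%:Z b%:Z; exists u, v; rewrite E.
  by move: ab; rewrite /coprime /gcdz => /eqP ->.
have a0' : a%:Z != 0 by lia.
pose y0 := `|(v * z %% a)%Z|%N.
have y0E : y0%:Z = (v * z %% a)%Z by rewrite gez0_abs ?modz_ge0.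
have y0a : (y0 < a)%N by have := ltz_pmod (v * z) (a0 : 0 < a%:Z); lia.
have dy0 : (a %| b%:Z * y0%:Z - z)%Z.
  rewrite y0E /modz -[z in _ - z]mulr1 -[in z * 1]uv; set q := (_ %/ _)%Z.
  by apply/dvdzP; exists (- u * z - b%:Z * q); ring.
rewrite (@eq_in_count _ _ (pred1 y0)) ?count_uniq_mem ?iota_uniq ?mem_iota ?y0a //.
move=> y; rewrite mem_iota => /andP[_ ya] /=; apply/idP/eqP => [dy|-> //].
have : (a %| b%:Z * (y%:Z - y0%:Z))%Z.
  have -> : b%:Z * (y%:Z - y0%:Z) =
      (b%:Z * y%:Z - z) - (b%:Z * y0%:Z - z) by ring.
  exact: rpredB.
rewrite Gauss_dvdzr // dvdzE => dya.
have [/eqP|d0] := posnP `|y%:Z - y0%:Z|%N; first by rewrite absz_eq0; lia.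
by have := dvdn_leq d0 dya; lia.
Qed.

(** East steps do not change levels modulo [a], so that the successive north
    steps start at the residues 0, b, 2b, ... *)
Lemma count_north_levels a b z P : (0 < a)%N -> coprime a b -> path_to b a P ->
  count (fun x => (a %| x - z)%Z) (north_levels a b 0 P) = 1%N.
Proof.
move=> a0 ab /andP[_ /eqP yP]; rewrite -(count_residue z a0 ab) -[X in iota 0 X]yP.
suff H l : count (fun x => (a %| x - z)%Z) (north_levels a b l P) =
  count (fun y : nat => (a %| l + b%:Z * y%:Z - z)%Z) (iota 0 (count id P)).
  by rewrite H; apply: eq_count => y; rewrite add0r.
elim: P l {yP} => [|[] P IH] l //=; rewrite IH.
  rewrite -[1%N]addn0 iotaDl count_map mulr0 addr0; congr addn.
  apply: eq_count => y /=.
  by have -> : l + b%:Z + b%:Z * y%:Z = l + b%:Z * y.+1%:Z by lia.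
apply: eq_count => y /=.
have -> : l - a%:Z + b%:Z * y%:Z - z = (l + b%:Z * y%:Z - z) - a%:Z by lia.
by rewrite rpredBr ?dvdzz.
Qed.

(** * The abacus and pairs of runners *)

(** The number of hook lengths [t < b] between the topmost bead [x - a] of a
    runner and the gaps [y], [y + a], ... of another, where [d = x - y]: the
    congruence and [t < d] say that [x - a - t] is one of these gaps. *)
Definition runner_hooks (a b : nat) (d : int) : nat :=
  count (fun t : nat => (t%:Z < d) && (a %| d - t%:Z)%Z) (iota 1 b.-1).

Definition pair_hooks (a b : nat) (A : seq int) : nat :=
  (\sum_(x <- A) \sum_(y <- A) runner_hooks a b (x - y))%N.

Lemma pair_hooks_perm a b A B : perm_eq A B -> pair_hooks a b A = pair_hooks a b B.
Proof.
move=> AB; rewrite /pair_hooks (perm_big _ AB).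
by apply: eq_bigr => x _; rewrite (perm_big _ AB).
Qed.

(** The reflection turns [x - y] into [y - x]; exchange the two summations. *)
Lemma pair_hooks_reflect a b c A :
  pair_hooks a b [seq c - x | x <- A] = pair_hooks a b A.
Proof.
rewrite /pair_hooks big_map exchange_big big_map /=.
by apply: eq_bigr => x _; apply: eq_bigr => y _; congr runner_hooks; lia.
Qed.

Lemma pair_hooks_rev_rot a b k P : rise a b P = 0 ->
  pair_hooks a b (north_levels a b 0 (rev (rot k P))) =
  pair_hooks a b (north_levels a b 0 P).
Proof.
move=> r0; have [c rc] := north_levels_rot k r0.
rewrite (north_levels_rev _ _ _ 0) (pair_hooks_perm _ _ (permEl (perm_rev _))).
rewrite pair_hooks_reflect (pair_hooks_perm _ _ rc).
rewrite -[RHS](pair_hooks_reflect a b 0) -[RHS](pair_hooks_reflect a b c).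
by rewrite -map_comp; congr pair_hooks; apply: eq_map => x /=; lia.
Qed.

Lemma dvdz_gap (a : nat) (x y : int) : (a %| y - x)%Z -> x < y -> x + a%:Z <= y.
Proof.
rewrite dvdzE => d xy; have d0 : (0 < `|(y - x)%R|)%N by lia.
by have := dvdn_leq d0 d; lia.
Qed.

(** Throughout this section [k] is a partition whose abacus is [A]: the elements
    of [A] are the lowest gaps of the [a] runners, when the negative integers
    count as beads and 0 as a gap. *)
Section Pairs.
Variables (a b : nat) (k : seq nat) (A : seq int).
Hypotheses (a_gt0 : (0 < a)%N) (kp : is_partition k).
Hypotheses (A_residue : forall z : int, count (fun x : int => (a %| x - z)%Z) A = 1%N).
Hypotheses (A_ge0 : {in A, forall x : int, 0 <= x}) (A0 : 0 \in A).
Hypothesis (kA : forall h : nat, (h \in first_column_hooks k) =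
  (0 < h)%N && has (fun x : int => (h%:Z < x) && (a %| x - h%:Z)%Z) A).

Let A_inj (x y : int) : x \in A -> y \in A -> (a %| x - y)%Z -> x = y.
Proof.
move=> xA yA xy; have := A_residue y; rewrite -size_filter.
case E : (filter _ _) => [|u [|v s]] // _.
have : x \in [:: u] by rewrite -E mem_filter xy.
have : y \in [:: u] by rewrite -E mem_filter subrr dvdz0.
by rewrite !inE => /eqP -> /eqP ->.
Qed.

Let A_uniq : uniq A.
Proof.
apply: count_mem_uniq => z; move: (z : int) => {z} x; have := A_residue x.
have : (count_mem x A <= count (fun y : int => (a %| (y - x)%R)%Z) A)%N.
  by apply: sub_count => y /eqP ->; rewrite subrr dvdz0.
have := has_pred1 x A; rewrite has_count; case: (x \in A); lia.
Qed.

(** The largest first-column hook in the residue class of [x] is [x - a], and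
    the class has no first-column hook when [x <= a]. *)
Let top_hooks : perm_eq
  [seq h <- first_column_hooks k | top_hook a (first_column_hooks k) h]
  [seq absz (x - a%:Z) | x : int <- A & a%:Z < x].
Proof.
have cong (m n : nat) : (m == n %[mod a])%N = (a %| m%:Z - n%:Z)%Z.
  by rewrite -eqz_mod_dvd !modz_nat.
apply: uniq_perm.
- by rewrite filter_uniq ?first_column_hooks_uniq.
- rewrite map_inj_in_uniq ?filter_uniq // => x y.
  by rewrite !mem_filter; lia.
move=> h; rewrite mem_filter /top_hook; apply/andP/mapP => [[/allP hmax]|[x]].
  rewrite kA => /andP[h0 /hasP[x xA /andP[hx dx]]].
  have xh := dvdz_gap dx hx.
  exists x; first by rewrite mem_filter xA andbT; lia.
  have h'E : (absz (x - a%:Z))%:Z = x - a%:Z by lia.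
  have := hmax (absz (x - a%:Z)).
  rewrite kA cong h'E.
  have -> : x - a%:Z - h%:Z = x - h%:Z - a%:Z by lia.
  rewrite rpredBr ?dvdzz // dx implyTb.
  suff -> : has (fun y : int => (x - a%:Z < y) && (a %| y - (x - a%:Z))%Z) A by lia.
  apply/hasP; exists x => //; apply/andP; split; first by lia.
  have -> : x - (x - a%:Z) = a%:Z by lia.
  exact: dvdzz.
rewrite mem_filter => /andP[ax xA] hE.
have hE' : h%:Z = x - a%:Z by lia.
split; last first.
  rewrite kA; apply/andP; split; first by lia.
  apply/hasP; exists x => //; apply/andP; split; first by lia.
  have -> : x - h%:Z = a%:Z by lia.
  exact: dvdzz.
apply/allP => h'; rewrite kA => /andP[_ /hasP[y yA /andP[h'y dy]]].
rewrite cong; apply/implyP => dh.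
have yx : y = x.
  apply: A_inj => //.
  have -> : y - x = (y - h'%:Z) + (h'%:Z - h%:Z) - a%:Z by lia.
  by apply: rpredB; [apply: rpredD | exact: dvdzz].
by have := dvdz_gap dy h'y; lia.
Qed.

(** The position [x - a - t] lies on the runner of exactly one [y] in [A], and
    it is a gap iff [y <= x - a - t], which amounts to [t < x - y] modulo the
    congruence. *)
Let count_runner (x : int) (t : nat) : x \in A -> (0 < t)%N ->
  count (fun y : int => (t%:Z < x - y) && (a %| x - y - t%:Z)%Z) A =
  [&& a%:Z < x, (t <= absz (x - a%:Z)%R)%N &
      (absz (x - a%:Z)%R - t)%N \notin first_column_hooks k].
Proof.
move=> xA t0.
have /hasP[y yA dy] : has (fun y : int => (a %| y - (x - t%:Z))%Z) A.
  by rewrite has_count A_residue.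
have dy' : (a %| x - y - t%:Z)%Z.
  have -> : x - y - t%:Z = - (y - (x - t%:Z)) by lia.
  by rewrite rpredN.
rewrite (@eq_in_count _ _ (fun u : int => (t%:Z < x - y) && (u == y))); last first.
  move=> u uA /=; have [->|uy] := eqVneq u y; first by rewrite dy' andbT.
  rewrite andbF; apply/negbTE; apply: contra uy => /andP[_ du].
  apply/eqP/A_inj => //.
  have -> : u - y = (x - y - t%:Z) - (x - u - t%:Z) by lia.
  exact: rpredB.
have -> : count (fun u : int => (t%:Z < x - y) && (u == y)) A = (t%:Z < x - y).
  case: (t%:Z < x - y); last by rewrite count_pred0.
  by rewrite (count_uniq_mem _ A_uniq) yA.
congr nat_of_bool; have y0 := A_ge0 yA.
apply/idP/and3P => [ty|[ax tx]].
  have := dvdz_gap (y := x - t%:Z) (x := y) (a := a).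
  have -> : x - t%:Z - y = x - y - t%:Z by lia.
  move=> /(_ dy' ltac:(lia)) yxt; split; try lia.
  rewrite kA; apply/negP => /andP[w0 /hasP[u uA /andP[wu du]]].
  have wE : (absz (x - a%:Z)%R - t)%N%:Z = x - a%:Z - t%:Z by lia.
  rewrite wE in wu du.
  suff uy : u = y by lia.
  apply: A_inj => //.
  have -> : u - y = (u - (x - a%:Z - t%:Z)) + (x - y - t%:Z) - a%:Z by lia.
  by apply: rpredB; [apply: rpredD | exact: dvdzz].
have wE : (absz (x - a%:Z)%R - t)%N%:Z = x - a%:Z - t%:Z by lia.
have dyw : (a %| y - (x - a%:Z - t%:Z))%Z.
  have -> : y - (x - a%:Z - t%:Z) = a%:Z - (x - y - t%:Z) by lia.
  by apply: rpredB => //; exact: dvdzz.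
rewrite kA negb_and => /orP[w0|/hasPn /(_ y yA)]; last by rewrite wE dyw; lia.
suff -> : y = 0 by lia.
apply: A_inj => //.
have -> : y - 0 = y - (x - a%:Z - t%:Z) by lia.
exact: dyw.
Qed.

Lemma skew_length_pair_hooks : skew_length a b k = pair_hooks a b A.
Proof.
rewrite skew_lengthE // -big_filter (perm_big _ top_hooks) /= big_map big_filter.
rewrite big_mkcond; apply: eq_big_seq => x xA.
under [RHS]eq_bigr do rewrite /runner_hooks -sum1_count big_mkcond.
rewrite exchange_big /=.
transitivity (\sum_(t <- iota 1 b.-1) [&& (a%:Z < x)%R, (t <= absz (x - a%:Z)%R)%N &
      (absz (x - a%:Z)%R - t)%N \notin first_column_hooks k])%N.
  case: ifP => ax; last by rewrite big1.
  by rewrite -sum1_count big_mkcond; apply: eq_bigr => t _; case: ifP.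
apply: eq_big_seq => t; rewrite mem_iota => /andP[t0 _].
by rewrite -count_runner // -sum1_count [LHS]big_mkcond.
Qed.
End Pairs.

(** * Skew length of a path *)

(** In the row of a north step starting at [(u, y)], the boxes below the path are
    those with [x = u + 1, u + 2, ...], of hook filling [b y - a u] minus a
    positive multiple of [a]. Positivity forces [x < b], hence the width of the
    grid imposes no further condition. *)
Lemma mem_positive_hooks a b P (h : nat) :
  (0 < a)%N -> path_to b a P ->
  (h \in positive_hooks a b P) = (0 < h)%N &&
    has (fun x : int => (h%:Z < x) && (a %| x - h%:Z)%Z) (north_levels a b 0 P).
Proof.
move=> a0 /andP[/eqP xP /eqP yP].
apply/mapP/andP => [[[x y]]|[h0 /hasP[z /north_levelsP[k [kP Nk ->]]]]].
  rewrite mem_filter => /andP[/andP[bxy /= hxy] /allpairsP[[x' y'] /= []]].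
  rewrite !mem_iota => xb ya [xE yE] hE; subst x' y'.
  have /box_belowP := bxy; rewrite xP yP => /(_ ltac:(lia) ltac:(lia)).
  case=> k [kP Nk ky kx]; split; first by lia.
  apply/hasP; exists (b%:Z * y%:Z - a%:Z * (xcoord P k)%:Z).
    by apply/north_levelsP; exists k; rewrite ky add0r.
  have hE' : h%:Z = b%:Z * y%:Z - a%:Z * x%:Z by lia.
  rewrite hE'; apply/andP; split; first by nia.
  by apply/dvdzP; exists (x%:Z - (xcoord P k)%:Z); ring.
rewrite add0r => /andP[hz /dvdzP[q qE]].
set y := ycoord P k in hz qE *; set u := xcoord P k in hz qE *.
have q0 : 0 < q by nia.
pose x := (u + absz q)%N.
have hE : h%:Z = b%:Z * y%:Z - a%:Z * x%:Z by rewrite /x; nia.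
have ya : (y < count id P)%N.
  rewrite /y -{2}(take_size P); exact: (@count_take_lt id P false).
have xb : (x <= b)%N.
  have : (a * x < b * a)%N by nia.
  by rewrite mulnC ltn_pmul2r // => /ltnW.
exists (x, y); last by rewrite /=; lia.
rewrite mem_filter; apply/andP; split.
  apply/andP; split; last by rewrite /=; lia.
  apply/box_belowP; rewrite ?xP ?ya //; first by rewrite /x; lia.
  by exists k; split=> //; rewrite /x; lia.
by apply/allpairsP; exists (x, y); rewrite !mem_iota /x; split=> //=; lia.
Qed.

Lemma path_skew_length_pair_hooks a b P :
  (0 < a)%N -> coprime a b -> dyck_path a b P ->
  path_skew_length a b P = pair_hooks a b (north_levels a b 0 P).
Proof.
move=> a0 ab /andP[Pto /allP Pd]; have [kp kH] := core_of_pathP a b P.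
have A_ge0 : {in north_levels a b 0 P, forall x : int, 0 <= x}.
  move=> x /north_levelsP[k [kP _ ->]].
  by have := Pd k; rewrite mem_iota => /(_ ltac:(lia)); lia.
apply: skew_length_pair_hooks => //.
- by move=> z; apply: count_north_levels.
- have /step_exists : (0 < count id P)%N by case/andP: Pto => _ /eqP ->.
  move=> /(_ false)[k [kP Nk]]; rewrite -/(ycoord P k) => ky.
  apply/north_levelsP; exists k; split=> //; rewrite ky.
  have := Pd k; rewrite mem_iota ky => /(_ ltac:(lia)); nia.
- by move=> h; rewrite kH mem_positive_hooks.
Qed.

Local Close Scope ring_scope.

Theorem theorem4p5 (a b : nat) (a_gt0 : 0 < a) (b_gt0 : 0 < b)
    (coprime_ab : coprime a b) (P : lattice_path) (dyckP : dyck_path a b P) :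
  path_skew_length a b P = path_skew_length a b (conj_path a b P).
Proof.
rewrite !path_skew_length_pair_hooks ?dyck_conj_path //.
rewrite pair_hooks_rev_rot // /rise.
by case/andP: dyckP => /andP[/eqP -> /eqP ->] _; lia.
Qed.
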